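(* Suppose that $\mathfrak{U}$ is a character amenable Banach algebra. Then for each $\phi\in\Delta(\mathfrak{U})$ and each Banach $\mathfrak{U}$-bimodule $X$ such that either $x\cdot a=\phi(a)x$ for all $a\in\mathfrak{U}$, $x\in X$, or $a\cdot x=\phi(a)x$ for all $a\in\mathfrak{U}$, $x\in X$, every continuous Jordan derivation from $\mathfrak{U}$ to $X$ is a derivation.
   Context: Banach algebras are complex. $\Delta(\mathfrak{U})$ is the set of all non-zero multiplicative linear functionals on $\mathfrak{U}$. For a Banach $\mathfrak{U}$-bimodule $X$, the dual $X^*$ is a Banach $\mathfrak{U}$-bimodule via $\langle a\cdot f,x\rangle=\langle f,x\cdot a\rangle$ and $\langle f\cdot a,x\rangle=\langle f,a\cdot x\rangle$. A linear map $\delta:\mathfrak{U}\to X$ is a derivation if $\delta(ab)=\delta(a)\cdot b+a\cdot\delta(b)$ for all $a,b\in\mathfrak{U}$; it is inner if for some $x\in X$, $\delta(a)=a\cdot x-x\cdot a$ for all $a$. $H^1(\mathfrak{U},X)$ is the quotient of the space of continuous derivations $\mathfrak{U}\to X$ by the space of inner derivations. $\mathfrak{U}$ is character amenable if $H^1(\mathfrak{U},X^* )=\{0\}$ for all $\phi\in\Delta(\mathfrak{U})\cup\{0\}$ and all Banach $\mathfrak{U}$-bimodules $X$ such that either $x\cdot a=\phi(a)x$ for all $a\in\mathfrak{U},x\in X$, or $a\cdot x=\phi(a)x$ for all $a\in\mathfrak{U},x\in X$. A linear map $\delta:\mathfrak{U}\to X$ is a Jordan derivation if $\delta(a\circ b)=\delta(a)\circ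 b+a\circ\delta(b)$ for all $a,b\in\mathfrak{U}$, where $a\circ b=ab+ba$ and $a\circ x=x\circ a=a\cdot x+x\cdot a$ for $a,b\in\mathfrak{U}$, $x\in X$. *)

(* Defs.v *)
From HB Require Import structures.
From mathcomp Require Import all_boot all_order all_algebra.
From mathcomp Require Import complex.
From mathcomp Require Import all_classical all_reals topology normedtype.

Set Implicit Arguments.
Unset Strict Implicit.
Unset Printing Implicit Defensive.

Import Order.TTheory GRing.Theory Num.Theory.
Import numFieldNormedType.Exports.

Local Open Scope classical_set_scope.
Local Open Scope complex_scope.
Local Open Scope ring_scope.

Section complex_norm.
Variable R : realType.
Implicit Types z : R[i].

Lemma ReC_ge0 z : 0 <= z -> (complex.Re z)%:C = z.
Proof. by case: z => a b; rewrite lecE /= => /andP[/eqP -> _]. Qed.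

Lemma ReC_norm (V : normedZmodType R[i]) (x : V) :
  (complex.Re `|x|)%:C = `|x|.
Proof. exact: ReC_ge0. Qed.

Lemma Re_mono z1 z2 : z1 <= z2 -> complex.Re z1 <= complex.Re z2.
Proof. by rewrite lecE => /andP[]. Qed.

Lemma normC_Re_le z : (`|complex.Re z|)%:C <= `|z|.
Proof.
case: z => a b; rewrite lecR /=.
by rewrite -sqrtr_sqr ler_wsqrtr// lerDl sqr_ge0.
Qed.

Lemma normC_Im_le z : (`|complex.Im z|)%:C <= `|z|.
Proof.
case: z => a b; rewrite lecR /=.
by rewrite -sqrtr_sqr ler_wsqrtr// lerDr sqr_ge0.
Qed.

Lemma normC_le_ReIm z : `|z| <= (`|complex.Re z| + `|complex.Im z|)%:C.
Proof.
case: z => a b; rewrite lecR /=.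
rewrite -[leRHS]ger0_norm ?addr_ge0// -sqrtr_sqr ler_wsqrtr//.
rewrite sqrrD !real_normK ?num_real// -addrA lerD2l lerDr.
by rewrite mulrn_wge0// mulr_ge0.
Qed.

Lemma complex_complete (F : set_system R[i]^o) :
  ProperFilter F -> cauchy F -> cvg F.
Proof.
move=> FF /cauchy_ballP cF.
have proj (p : R[i] -> R) : (forall x y, p (x - y) = p x - p y) ->
    (forall z, (`|p z|)%:C <= `|z|) -> [cvg (p @ F) in R^o].
  move=> pB ple; apply: (@cauchy_cvg R^o (p @ F) _); apply/cauchy_ballP => e e0.
  have e0' : (0 : R[i]) < e%:C by rewrite ltcR.
  have [[P Q] [/= FP FQ] PQ] := cF _ e0'.
  exists (p @` P, p @` Q) => /=.
    by split; [apply: filterS FP | apply: filterS FQ] => x ?; exists x.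
  move=> [_ _] [/= [x Px <-] [y Qy <-]].
  have := PQ (x, y) (conj Px Qy); rewrite -!ball_normE /= => xy.
  by rewrite -ltcR -pB (le_lt_trans (ple _)).
have /cvg_ex[a Fa] := @proj (@complex.Re R) ltac:(by move=> [? ?] [? ?])
  normC_Re_le.
have /cvg_ex[b Fb] := @proj (@complex.Im R) ltac:(by move=> [? ?] [? ?])
  normC_Im_le.
apply/cvg_ex; exists (a +i* b)%C; apply/cvgrPdist_lt => e e0.
have e2 : 0 < complex.Re e / 2.
  by rewrite divr_gt0// -ltcR ReC_ge0// ltW.
move/cvgrPdist_lt : Fa => /(_ _ e2) Fa; move/cvgrPdist_lt : Fb => /(_ _ e2) Fb.
near=> z.
rewrite (le_lt_trans (normC_le_ReIm _))// -[ltRHS]ReC_ge0 ?ltW// ltcR.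
have -> : complex.Re (a +i* b - z)%C = a - complex.Re z by case: (z).
have -> : complex.Im (a +i* b - z)%C = b - complex.Im z by case: (z).
rewrite [ltRHS]splitr ltrD//.
- by near: z; exact: Fa.
- by near: z; exact: Fb.
Unshelve. all: by end_near. Qed.

End complex_norm.

Section dual.
Variables (R : realType) (X : normedModType R[i]).

Definition dual_pred : {pred X -> R[i]^o} :=
  mem [set f : X -> R[i]^o | linear f /\ continuous f].

Record dual := Dual { dual_fun :> X -> R[i]^o ; _ : dual_fun \in dual_pred }.

HB.instance Definition _ := [isSub for dual_fun].
HB.instance Definition _ := [Choice of dual by <:].

Lemma dual_submod_closed : submod_closed dual_pred.
Proof.
split; first by rewrite inE; split; [move=> a x y /=|];
  rewrite /GRing.zero/= /cst ?scaler0 ?addr0//; move=> x; exact: cvg_cst.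
move=> a f g /set_mem[fl fc] /set_mem[gl gc].
apply/mem_set; split.
  move=> b x y.
  change (a *: f (b *: x + y) + g (b *: x + y) =
    b *: (a *: f x + g x) + (a *: f y + g y)).
  rewrite (fl b x y) (gl b x y).
  by rewrite !scalerDr !scalerA (mulrC a b) addrACA.
by move=> x; apply: cvgD; [apply: cvgZr; exact: fc|exact: gc].
Qed.

HB.instance Definition _ := GRing.isSubmodClosed.Build _ _ dual_pred
  dual_submod_closed.
HB.instance Definition _ := [SubChoice_isSubLmodule of dual by <:].

Lemma dual_linear (f : dual) : linear f.
Proof. by case: f => f /=; rewrite inE => -[]. Qed.

HB.instance Definition _ (f : dual) :=
  GRing.isLinear.Build R[i] X R[i]^o _ f (dual_linear f).

Lemma dual_continuous (f : dual) : continuous f.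
Proof. by case: f => f /=; rewrite inE => -[]. Qed.

Lemma dualP (f g : dual) : f =1 g -> f = g.
Proof. by move=> fg; apply/val_inj/funext. Qed.

Lemma dual_addE (f g : dual) x : (f + g) x = f x + g x. Proof. by []. Qed.
Lemma dual_oppE (f : dual) x : (- f) x = - f x. Proof. by []. Qed.
Lemma dual_scaleE a (f : dual) x : (a *: f) x = a *: f x. Proof. by []. Qed.

(* the norm of f is the supremum of |f x| over the unit ball; norms take their
   values in the nonnegative reals of R[i], hence complex.Re and %:C *)
Definition dual_norm (f : dual) : R[i] :=
  (sup [set complex.Re `|f x| | x in [set x : X | `|x| <= 1]])%:C.

Lemma dual_bounded (f : dual) :
  exists2 k : R[i], 0 < k & forall x, `|f x| <= k * `|x|.
Proof.
have /linear_bounded_continuous/linear_boundedP := @dual_continuous f.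
by move=> /pinfty_ex_gt0[k k0 fk]; exists k.
Qed.

Lemma dual_has_sup (f : dual) :
  has_sup [set complex.Re `|f x| | x in [set x : X | `|x| <= 1]].
Proof.
split; first by exists (complex.Re `|f 0|), 0 => //=; rewrite normr0.
have [k k0 fk] := dual_bounded f; exists (complex.Re k) => _ [x x1 <-].
by apply: Re_mono; rewrite (le_trans (fk x))// ler_piMr// ltW.
Qed.

Lemma dual_norm_ub1 (f : dual) x : `|x| <= 1 -> `|f x| <= dual_norm f.
Proof.
move=> x1; rewrite -ReC_norm lecR; apply: ub_le_sup; last by exists x.
exact: (dual_has_sup f).2.
Qed.

Lemma dual_norm_le (f : dual) M :
  (forall x, `|x| <= 1 -> `|f x| <= M) -> dual_norm f <= M.
Proof.
move=> fM; have M0 : 0 <= M by apply: le_trans (fM 0 _); rewrite ?normr0.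
rewrite -[leRHS]ReC_ge0// lecR; apply: ge_sup; first exact: (dual_has_sup f).1.
by move=> _ [x x1 <-]; apply/Re_mono/fM.
Qed.

Lemma dual_norm_ub (f : dual) x : `|f x| <= dual_norm f * `|x|.
Proof.
have [->|x0] := eqVneq x 0; first by rewrite linear0 !normr0 mulr0.
rewrite -ler_pdivrMr ?normr_gt0// mulrC.
have := @dual_norm_ub1 f (`|x|^-1 *: x).
rewrite linearZ/= !normrZ normfV normr_id mulVf ?normr_eq0//; exact.
Qed.

Lemma dual_normD (f g : dual) : dual_norm (f + g) <= dual_norm f + dual_norm g.
Proof.
apply: dual_norm_le => x x1; rewrite dual_addE (le_trans (ler_normD _ _))//.
by apply: lerD; exact: dual_norm_ub1.
Qed.

Lemma dual_norm_ge0 (f : dual) : 0 <= dual_norm f.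
Proof. by apply: le_trans (dual_norm_ub1 f (x := 0) _); rewrite ?normr0. Qed.

Lemma dual_normZ a (f : dual) : dual_norm (a *: f) = `|a| * dual_norm f.
Proof.
have le_normZ b (h : dual) : dual_norm (b *: h) <= `|b| * dual_norm h.
  apply: dual_norm_le => x x1.
  by rewrite dual_scaleE normrZ ler_wpM2l// dual_norm_ub1.
apply/le_anti; rewrite le_normZ /=.
have [->|a0] := eqVneq a 0; first by rewrite normr0 mul0r dual_norm_ge0.
have := le_normZ a^-1 (a *: f).
by rewrite scalerA mulVf// scale1r normfV -ler_pdivrMl ?invrK// ?invr_gt0 ?normr_gt0.
Qed.

Lemma dual_norm0_eq0 (f : dual) : dual_norm f = 0 -> f = 0.
Proof.
move=> f0; apply: dualP => x; apply/eqP; rewrite -normr_le0.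
by rewrite (le_trans (dual_norm_ub f x))// f0 mul0r.
Qed.

HB.instance Definition _ := Lmodule_isNormed.Build R[i] dual
  dual_normD dual_normZ dual_norm0_eq0.

Lemma ler_dual_norm (f : dual) x : `|f x| <= `|f| * `|x|.
Proof. exact: dual_norm_ub. Qed.

Lemma dual_norm_leM (f : dual) M : 0 <= M ->
  (forall x, `|f x| <= M * `|x|) -> `|f| <= M.
Proof.
move=> M0 fM; apply: dual_norm_le => x x1.
by rewrite (le_trans (fM x))// ler_piMr.
Qed.

Lemma dual_mem (g : X -> R[i]^o) (k : R[i]) : 0 <= k ->
  linear g -> (forall x, `|g x| <= k * `|x|) -> g \in dual_pred.
Proof.
move=> k0 gl gk; apply/mem_set; split=> //.
pose G : {linear X -> R[i]^o} :=
  HB.pack g (GRing.isLinear.Build _ _ _ _ g gl).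
apply/(@linear_bounded_continuous _ _ _ G)/linear_boundedP.
near=> r => x; rewrite (le_trans (gk x))// ler_wpM2r//.
by near: r; apply: nbhs_pinfty_ge; exact: ger0_real.
Unshelve. all: by end_near. Qed.

Lemma dual_complete (F : set_system dual) :
  ProperFilter F -> cauchy F -> cvg F.
Proof.
move=> FF /cauchy_ballP cF.
have {}cF e : 0 < e -> exists2 P : set dual, F P &
    forall f h, P f -> P h -> `|f - h| < e.
  move=> e0; have [[P Q] [/= FP FQ] PQ] := cF _ e0.
  exists (P `&` Q); first exact: filterI.
  move=> f h [Pf _] [_ Qh]; have := PQ (f, h) (conj Pf Qh).
  by rewrite -ball_normE.
have ptw x : cvg ((fun f : dual => f x) @ F).
  apply: complex_complete.
  apply/cauchy_ballP => e e0.
  have x0 : 0 < `|x| + 1 by rewrite ltr_wpDl.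
  have [P FP PP] := cF (e / (`|x| + 1)) (divr_gt0 e0 x0).
  exists ((fun f : dual => f x) @` P, (fun f : dual => f x) @` P) => /=.
    by split; apply: (@filterS _ F _ P) => // f Pf; exists f.
  move=> [_ _] [/= [f Pf <-] [h Ph <-]]; rewrite -ball_normE /=.
  have -> : f x - h x = (f - h) x by [].
  rewrite (le_lt_trans (ler_dual_norm _ _))//.
  rewrite (@le_lt_trans _ _ (`|f - h| * (`|x| + 1))) ?ler_wpM2l ?lerDl//.
  by rewrite -ltr_pdivlMr// PP.
pose g x : R[i]^o := lim ((fun f : dual => f x) @ F).
have gE x : (fun f : dual => f x) @ F --> g x by exact: ptw.
have glin : linear g.
  move=> a x y; apply: (cvg_unique _ (gE _)) => //.
  rewrite (_ : (fun f : dual => f _) = (fun f => a *: f x + f y)).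
    by apply: cvgD => //; exact: cvgZr.
  by apply/funext => f; rewrite linearP.
have gclose e : 0 < e -> exists2 P : set dual, F P &
    forall f, P f -> forall x, `|f x - g x| <= e * `|x|.
  move=> e0; have [P FP PP] := cF e e0; exists P => // f Pf x.
  have key d : 0 < d -> `|f x - g x| <= e * `|x| + d.
    move=> d0; have /cvgrPdist_lt/(_ _ d0) gd := gE x.
    have [h [Ph gh]] := filter_ex (filterI FP gd).
    rewrite -(subrKA (h x)) (le_trans (ler_normD _ _))// lerD//.
      have -> : f x - h x = (f - h) x by [].
      by rewrite (le_trans (ler_dual_norm _ _))// ler_wpM2r// ltW// PP.
    by rewrite distrC ltW.
  have ex0 : 0 <= e * `|x| by rewrite mulr_ge0// ltW.
  suff : complex.Re `|f x - g x| <= complex.Re (e * `|x|).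
    by rewrite -lecR ReC_norm ReC_ge0.
  apply/ler_addgt0Pr => d d0.
  have := key d%:C; rewrite ltcR => /(_ d0)/Re_mono.
  by rewrite -{1}(ReC_ge0 ex0).
have gdual : g \in dual_pred.
  have [P FP /= Pg] := gclose 1 ltr01; have [f Pf] := filter_ex FP.
  apply: (@dual_mem _ (1 + `|f|)); rewrite ?addr_ge0// => x.
  rewrite -[g x](subrK (f x)) (le_trans (ler_normD _ _))// mulrDl lerD//.
    by rewrite distrC Pg.
  exact: ler_dual_norm.
apply/cvg_ex; exists (Dual gdual); apply/cvgrPdist_le => e e0.
have [P FP Pg] := gclose e e0; apply: filterS FP => f Pf.
rewrite distrC; apply: dual_norm_leM; first exact: ltW.
exact: Pg.
Qed.

HB.instance Definition _ := Uniform_isComplete.Build dual dual_complete.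

End dual.

(* no unit is assumed, hence the product is not that of an algType *)
HB.mixin Record isBanachAlgebra (R : realType) A
    & CompleteNormedModule R[i] A := {
  bmul : A -> A -> A;
  bmulA : associative bmul;
  bmulDl : left_distributive bmul +%R;
  bmulDr : right_distributive bmul +%R;
  bmulZl : forall (k : R[i]) (a b : A), bmul (k *: a) b = k *: bmul a b;
  bmulZr : forall (k : R[i]) (a b : A), bmul a (k *: b) = k *: bmul a b;
  ler_norm_bmul : forall a b : A, `|bmul a b| <= `|a| * `|b|
}.

#[short(type="banachAlgType")]
HB.structure Definition BanachAlgebra (R : realType) :=
  {A of CompleteNormedModule R[i] A & isBanachAlgebra R A}.

Notation "a ** b" := (bmul a b) (at level 40, left associativity) : ring_scope.

(* the actions are jointly bounded; they are not required to be contractive *)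
HB.mixin Record isBanachBimodule (R : realType) (A : banachAlgType R) X
    & CompleteNormedModule R[i] X := {
  lact : A -> X -> X;
  ract : X -> A -> X;
  lactDl : forall a b x, lact (a + b) x = lact a x + lact b x;
  lactZl : forall (k : R[i]) a x, lact (k *: a) x = k *: lact a x;
  lactDr : forall a x y, lact a (x + y) = lact a x + lact a y;
  lactZr : forall (k : R[i]) a x, lact a (k *: x) = k *: lact a x;
  ractDl : forall x y a, ract (x + y) a = ract x a + ract y a;
  ractZl : forall (k : R[i]) x a, ract (k *: x) a = k *: ract x a;
  ractDr : forall x a b, ract x (a + b) = ract x a + ract x b;
  ractZr : forall (k : R[i]) x a, ract x (k *: a) = k *: ract x a;
  lact_mul : forall a b x, lact (a ** b) x = lact a (lact b x);
  ract_mul : forall x a b, ract x (a ** b) = ract (ract x a) b;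
  lract : forall a x b, ract (lact a x) b = lact a (ract x b);
  lact_bounded : exists2 k : R[i], 0 <= k &
    forall a x, `|lact a x| <= k * `|a| * `|x|;
  ract_bounded : exists2 k : R[i], 0 <= k &
    forall x a, `|ract x a| <= k * `|x| * `|a|
}.

#[short(type="banachBimodType")]
HB.structure Definition BanachBimodule (R : realType) (A : banachAlgType R) :=
  {X of CompleteNormedModule R[i] X & isBanachBimodule R A X}.

Notation "a *> x" := (lact a x) (at level 40, left associativity) : ring_scope.
Notation "x <* a" := (ract x a) (at level 40, left associativity) : ring_scope.

Section dual_bimodule.
Variables (R : realType) (A : banachAlgType R) (X : banachBimodType A).
Implicit Types (a b : A) (f g : dual X).

Fact dual_lact_proof a f : (fun x => f (x <* a)) \in @dual_pred R X.
Proof.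
have [k k0 Xk] := @ract_bounded _ _ X.
apply: (@dual_mem _ _ _ (`|f| * (k * `|a|))).
- by rewrite !mulr_ge0.
- by move=> c x y; rewrite ractDl ractZl linearP.
- move=> x; rewrite (le_trans (ler_dual_norm _ _))// -mulrA ler_wpM2l//.
  by rewrite mulrAC.
Qed.

Fact dual_ract_proof f a : (fun x => f (a *> x)) \in @dual_pred R X.
Proof.
have [k k0 Xk] := @lact_bounded _ _ X.
apply: (@dual_mem _ _ _ (`|f| * (k * `|a|))).
- by rewrite !mulr_ge0.
- by move=> c x y; rewrite lactDr lactZr linearP.
- by move=> x; rewrite (le_trans (ler_dual_norm _ _))// -mulrA ler_wpM2l.
Qed.

Definition dual_lact a f : dual X := Dual (dual_lact_proof a f).
Definition dual_ract f a : dual X := Dual (dual_ract_proof f a).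

Let dual_lactDl a b f : dual_lact (a + b) f = dual_lact a f + dual_lact b f.
Proof. by apply: dualP => x /=; rewrite ractDr linearD. Qed.

Let dual_lactZl (k : R[i]) a f : dual_lact (k *: a) f = k *: dual_lact a f.
Proof. by apply: dualP => x /=; rewrite ractZr linearZ. Qed.

Let dual_lactDr a f g : dual_lact a (f + g) = dual_lact a f + dual_lact a g.
Proof. exact: dualP. Qed.

Let dual_lactZr (k : R[i]) a f : dual_lact a (k *: f) = k *: dual_lact a f.
Proof. exact: dualP. Qed.

Let dual_ractDl f g a : dual_ract (f + g) a = dual_ract f a + dual_ract g a.
Proof. exact: dualP. Qed.

Let dual_ractZl (k : R[i]) f a : dual_ract (k *: f) a = k *: dual_ract f a.
Proof. exact: dualP. Qed.

Let dual_ractDr f a b : dual_ract f (a + b) = dual_ract f a + dual_ract f b.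
Proof. by apply: dualP => x /=; rewrite lactDl linearD. Qed.

Let dual_ractZr (k : R[i]) f a : dual_ract f (k *: a) = k *: dual_ract f a.
Proof. by apply: dualP => x /=; rewrite lactZl linearZ. Qed.

Let dual_lact_mul a b f : dual_lact (a ** b) f = dual_lact a (dual_lact b f).
Proof. by apply: dualP => x /=; rewrite ract_mul. Qed.

Let dual_ract_mul f a b : dual_ract f (a ** b) = dual_ract (dual_ract f a) b.
Proof. by apply: dualP => x /=; rewrite lact_mul. Qed.

Let dual_lract a f b : dual_ract (dual_lact a f) b = dual_lact a (dual_ract f b).
Proof. by apply: dualP => x /=; rewrite lract. Qed.

Let dual_lact_bounded : exists2 k : R[i], 0 <= k &
  forall a f, `|dual_lact a f| <= k * `|a| * `|f|.
Proof.
have [k k0 Xk] := @ract_bounded _ _ X; exists k => // a f.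
apply: dual_norm_leM => [|x]; first by rewrite !mulr_ge0.
rewrite (le_trans (ler_dual_norm f (x <* a)))//.
by rewrite [leRHS]mulrAC [leRHS]mulrC ler_wpM2l// mulrAC.
Qed.

Let dual_ract_bounded : exists2 k : R[i], 0 <= k &
  forall f a, `|dual_ract f a| <= k * `|f| * `|a|.
Proof.
have [k k0 Xk] := @lact_bounded _ _ X; exists k => // f a.
apply: dual_norm_leM => [|x]; first by rewrite !mulr_ge0.
rewrite (le_trans (ler_dual_norm f (a *> x)))//.
by rewrite [k * _]mulrC -!mulrA ler_wpM2l// mulrA.
Qed.

HB.instance Definition _ := isBanachBimodule.Build R A (dual X)
  dual_lactDl dual_lactZl dual_lactDr dual_lactZr
  dual_ractDl dual_ractZl dual_ractDr dual_ractZr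
  dual_lact_mul dual_ract_mul dual_lract dual_lact_bounded dual_ract_bounded.

Lemma dual_lactE a f x : (a *> f) x = f (x <* a). Proof. by []. Qed.
Lemma dual_ractE a f x : (f <* a) x = f (a *> x). Proof. by []. Qed.

End dual_bimodule.

Section derivations.
Variables (R : realType) (A : banachAlgType R) (X : banachBimodType A).
Implicit Type d : A -> X.

Definition derivation d :=
  linear d /\ forall a b, d (a ** b) = d a <* b + a *> d b.

Definition inner_derivation d := exists x : X, forall a, d a = a *> x - x <* a.

Definition jprod (a b : A) : A := a ** b + b ** a.

(* both a o x and x o a *)
Definition jact (a : A) (x : X) : X := a *> x + x <* a.

Definition jordan_derivation d :=
  linear d /\ forall a b, d (jprod a b) = jact b (d a) + jact a (d b).

Definition Z1 : set (A -> X) := [set d | derivation d /\ continuous d].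
Definition B1 : set (A -> X) := [set d | inner_derivation d].

(* the elements of the quotient H^1 = Z^1 / B^1 are the cosets d + B^1 *)
Definition H1 : set (set (A -> X)) := [set [set d \+ b | b in B1] | d in Z1].

(* the zero element of H^1 is the coset B^1 *)
Definition H1_trivial : Prop := H1 = [set B1].

End derivations.

Arguments H1_trivial {R A} X.

Definition Delta (R : realType) (A : banachAlgType R) : set (A -> R[i]) :=
  [set phi | [/\ scalar phi, forall a b, phi (a ** b) = phi a * phi b &
                 phi <> cst 0]].
Arguments Delta {R} A.

Definition character_action (R : realType) (A : banachAlgType R)
    (phi : A -> R[i]) (X : banachBimodType A) : Prop :=
  (forall (a : A) (x : X), x <* a = phi a *: x) \/
  (forall (a : A) (x : X), a *> x = phi a *: x).

Definition character_amenable (R : realType) (A : banachAlgType R) : Prop :=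
  forall phi : A -> R[i], (Delta A `|` [set cst 0]) phi ->
  forall X : banachBimodType A, character_action phi X ->
  H1_trivial (dual X).

(* Main.v *)
(* Let I be the kernel of phi. Applied to the bimodule A^* with one action given
   by a character and the other by translation (twisted so as to kill phi),
   character amenability yields elements of A^** which act as one-sided units
   for I and vanish on phi. They combine into a two-sided mean M : A^* -> C which
   behaves like the limit along a two-sided approximate identity of I. If A acts
   on the right of X through phi, a continuous Jordan derivation T satisfies
   T(ab + ba) = aT(b) + bT(a) on I, hence T(abc + cba) = abT(c) + cbT(a), and
   letting c tend along M gives T(ab) = aT(b) on I, tested against functionals,
   which separate points by Hahn-Banach. As I = closure of I^2 has codimension 1,
   the identity T(ab) = phi(b)T(a) + aT(b) follows on A. The case of an action
   on the left through phi is the same statement for the opposite algebra. *)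

Require Import Defs.
From HB Require Import structures.
From mathcomp Require Import all_boot all_order all_algebra.
From mathcomp Require Import complex.
From mathcomp Require Import all_classical all_reals topology normedtype.
From mathcomp Require Import ring lra.

Set Implicit Arguments.
Unset Strict Implicit.
Unset Printing Implicit Defensive.

Import Order.TTheory GRing.Theory Num.Theory.
Import numFieldNormedType.Exports.

Local Open Scope classical_set_scope.
Local Open Scope complex_scope.
Local Open Scope ring_scope.

(** * Hahn-Banach separation, by way of minimal sublinear functionals *)

Section hahn_banach.
Variables (R : realType) (V : normedModType R[i]).
Implicit Types (q : V -> R) (x y : V) (r : R).

Definition sublinear q :=
  (forall x y, q (x + y) <= q x + q y) /\
  (forall r x, 0 <= r -> q (r%:C *: x) = r * q x).

(** Applying the homogeneity inequality to the inverse of [r] as well yields equality. *)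
Lemma sublinear_le q : (forall x y, q (x + y) <= q x + q y) -> q 0 = 0 ->
  (forall r x, 0 < r -> q (r%:C *: x) <= r * q x) -> sublinear q.
Proof.
move=> qD q0 qZ; split=> // r x; rewrite le_eqVlt => /predU1P[<-|r0].
  by rewrite rmorph0 scale0r mul0r.
apply/le_anti; rewrite qZ//= -ler_pdivlMl//.
have := qZ r^-1 (r%:C *: x); rewrite invr_gt0 => /(_ r0).
by rewrite scalerA -rmorphM mulVf ?gt_eqF// scale1r.
Qed.

Lemma sublinear0 q : sublinear q -> q 0 = 0.
Proof. by move=> [_ /(_ 0 0 (lexx _))]; rewrite scaler0 mul0r. Qed.

Lemma sublinear_oppr q x : sublinear q -> - q (- x) <= q x.
Proof.
by move=> qs; have := qs.1 x (- x); rewrite subrr sublinear0//; lra.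
Qed.

(* On a minimal sublinear functional [tilt q y] and [q] coincide, which is
   superadditivity of [q]. *)
Definition tilt q y x : R :=
  inf [set q (x + t%:C *: y) - t * q y | t in [set t | 0 <= t]].

Lemma tilt_lbound q y x : sublinear q ->
  lbound [set q (x + t%:C *: y) - t * q y | t in [set t | 0 <= t]] (- q (- x)).
Proof.
move=> qs _ [t /= t0 <-]; rewrite -qs.2//.
have := qs.1 (x + t%:C *: y) (- x); rewrite addrAC subrr add0r; lra.
Qed.

Lemma tilt_le q y x t : sublinear q -> 0 <= t ->
  tilt q y x <= q (x + t%:C *: y) - t * q y.
Proof.
move=> qs t0; apply: ge_inf; last by exists t.
by exists (- q (- x)); exact: tilt_lbound.
Qed.

Lemma le_tilt q y x r :
  (forall t, 0 <= t -> r <= q (x + t%:C *: y) - t * q y) -> r <= tilt q y x.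
Proof.
move=> h; apply: lb_le_inf; last by move=> _ [t /= t0 <-]; exact: h.
by exists (q (x + 0%:C *: y) - 0 * q y), 0 => /=.
Qed.

Lemma tilt_le_id q y x : sublinear q -> tilt q y x <= q x.
Proof.
move=> qs; have := tilt_le y x qs (lexx 0).
by rewrite rmorph0 scale0r mul0r addr0 subr0.
Qed.

Lemma tilt_le_subr q y x : sublinear q -> tilt q y x <= q (x + y) - q y.
Proof.
by move=> qs; have := tilt_le y x qs ler01; rewrite rmorph1 scale1r mul1r.
Qed.

Lemma sublinear_tilt q y : sublinear q -> sublinear (tilt q y).
Proof.
move=> qs; apply: sublinear_le => [x x'||r x r0].
- rewrite -lerBlDr; apply: le_tilt => t t0.
  rewrite lerBlDl -lerBlDr; apply: le_tilt => s s0.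
  (* The parameters chosen for the two summands add up to one for the sum. *)
  have := tilt_le y (x + x') qs (addr_ge0 s0 t0).
  have := qs.1 (x + t%:C *: y) (x' + s%:C *: y).
  rewrite addrACA -scalerDl -rmorphD [t + s]addrC /= mulrDl; lra.
- apply/le_anti; rewrite -{1}(sublinear0 qs) tilt_le_id//=.
  apply: le_tilt => t t0; have := @tilt_lbound q y 0 qs.
  by rewrite oppr0 sublinear0// oppr0; apply; exists t.
- rewrite -ler_pdivrMl//; apply: le_tilt => t t0; rewrite ler_pdivrMl//.
  rewrite mulrBr -qs.2 ?(ltW r0)// scalerDr scalerA -rmorphM mulrA.
  by apply: tilt_le => //; rewrite mulr_ge0// ltW.
Qed.

(** Zorn's lemma: a chain is bounded below by its pointwise infimum, which is finite because every
    sublinear functional below [q] is at least [- q (- x)] at [x]. *)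
Lemma minimal_sublinear q : sublinear q ->
  exists p, [/\ sublinear p, forall x, p x <= q x &
    forall p', sublinear p' -> (forall x, p' x <= p x) -> p' = p].
Proof.
move=> qs.
pose T := {p : V -> R | sublinear p /\ forall x, p x <= q x}.
(* The order is reversed, so that maximality for [Rel] is minimality of the functional. *)
pose Rel (s t : T) := `[< forall x, sval t x <= sval s x >].
have [||A Atot|p pmin] :=
  @ZL_preorder T (exist _ q (conj qs (fun=> lexx _))) Rel.
- by move=> t; apply/asboolP.
- move=> r s t /asboolP rs /asboolP st; apply/asboolP => x.
  exact: le_trans (st x) (rs x).
- have [[p0 Ap0]|A0] := pselect (exists p, A p); last first.
    exists (exist _ q (conj qs (fun=> lexx _))) => s As.
    by exfalso; apply: A0; exists s.
  pose S x := [set sval p x | p in A].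
  have lbS x : lbound (S x) (- q (- x)).
    move=> _ [p Ap <-]; case: p Ap => p [ps pq] /= _.
    by rewrite (le_trans _ (sublinear_oppr x ps))// lerN2.
  have infS x p : A p -> inf (S x) <= sval p x.
    by move=> Ap; apply: ge_inf; [exists (- q (- x)) | exists p].
  have Sinf x r : (forall p, A p -> r <= sval p x) -> r <= inf (S x).
    move=> h; apply: lb_le_inf; first by exists (sval p0 x), p0.
    by move=> _ [p Ap <-]; exact: h.
  have iS : sublinear (fun x => inf (S x)).
    apply: sublinear_le => [x y||r x r0].
    + rewrite -lerBlDr; apply: (Sinf) => p Ap.
      rewrite lerBlDl -lerBlDr; apply: (Sinf) => p' Ap'.
      rewrite lerBlDl.
      have [/asboolP pp'|/asboolP pp'] := Atot _ _ Ap Ap'.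
      * rewrite (le_trans (infS _ _ Ap'))// (le_trans ((svalP p').1.1 _ _))//.
        by rewrite lerD2r.
      * rewrite (le_trans (infS _ _ Ap))// (le_trans ((svalP p).1.1 _ _))//.
        by rewrite lerD2l.
    + apply/le_anti/andP; split.
        by rewrite (le_trans (infS _ _ Ap0))// sublinear0//; exact: (svalP p0).1.
      by apply: (Sinf) => p Ap; rewrite sublinear0//; exact: (svalP p).1.
    + rewrite -ler_pdivrMl//; apply: (Sinf) => p Ap; rewrite ler_pdivrMl//.
      by rewrite -(svalP p).1.2 ?infS// ltW.
  have iSq x : inf (S x) <= q x.
    by rewrite (le_trans (infS _ _ Ap0))//; exact: (svalP p0).2.
  exists (exist _ (fun x => inf (S x)) (conj iS iSq) : T) => s As.
  apply/asboolP => x /=.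
  exact: infS.
exists (sval p); split; [exact: (svalP p).1|exact: (svalP p).2|].
move=> p' p's p'p.
have p'q x : p' x <= q x by rewrite (le_trans (p'p x))//; exact: (svalP p).2.
have /asboolP pp' := pmin (exist _ p' (conj p's p'q) : T) ltac:(exact/asboolP).
by apply/funext => x; apply/le_anti; rewrite p'p pp'.
Qed.

Lemma sublinear_dominates_linear q : sublinear q ->
  exists u : V -> R, [/\ forall x y, u (x + y) = u x + u y,
    forall r x, u (r%:C *: x) = r * u x & forall x, u x <= q x].
Proof.
move=> /minimal_sublinear[p [ps pq pmin]].
have pD x y : p (x + y) = p x + p y.
  apply/le_anti; rewrite ps.1/= -lerBrDr.
  (* Minimality makes tilting leave [p] fixed; with [tilt_le_subr] this is superadditivity. *)
  have <- : tilt p y x = p x.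
    rewrite (pmin (tilt p y)) => // [|z]; first exact: sublinear_tilt.
    exact: tilt_le_id.
  exact: tilt_le_subr.
have pN x : p (- x) = - p x.
  by have := pD x (- x); rewrite subrr sublinear0//; lra.
exists p; split=> // r x.
have [r0|/ltW r0] := leP 0 r; first exact: ps.2.
rewrite -[r]opprK rmorphN scaleNr pN ps.2 ?oppr_ge0//; lra.
Qed.

(** A real functional [u] dominated by the norm tilted at [x] satisfies [u (- x) <= - N x]. Its
    complexification [u z - i u (i z)] is bounded with real part [u], so its vanishing at [x] forces
    the norm of [x] to be zero. *)
Lemma dual_separates x : (forall f : dual V, f x = 0) -> x = 0.
Proof.
pose N (z : V) : R := complex.Re `|z|.
have NC z : (N z)%:C = `|z| by exact: ReC_norm.
have Ns : sublinear N.
  split=> [y z|r y r0].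
    by rewrite -lecR rmorphD /= !NC ler_normD.
  apply: (@complexI R); rewrite rmorphM /= !NC normrZ; congr *%R.
  by rewrite ger0_norm// ler0c.
move=> fx; apply/eqP; rewrite -normr_le0 -NC lecR.
have [u [uD uZ uN]] := sublinear_dominates_linear (sublinear_tilt x Ns).
have {}uNN z : u z <= N z by rewrite (le_trans (uN z))// tilt_le_id.
have uNx : u (- x) <= - N x.
  rewrite (le_trans (uN _))// (le_trans (tilt_le_subr _ _ Ns))//.
  by rewrite addNr sublinear0// sub0r.
have u0 : u 0 = 0 by have := uD 0 0; rewrite addr0; lra.
have uNE z : u (- z) = - u z by have := uD z (- z); rewrite subrr u0; lra.
have absu z : `|u z| <= N z.
  rewrite ler_norml uNN andbT lerNl -uNE (le_trans (uNN _))//.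
  by rewrite /N normrN.
pose f z : R[i]^o := (u z +i* - u ('i *: z))%C.
have uC a b z : u ((a +i* b)%C *: z) = a * u z + b * u ('i *: z).
  rewrite -uZ -uZ -uD scalerA -scalerDl; congr (u (_ *: _)).
  by simpc.
have fl : linear f.
  move=> [a b] y z; rewrite /f.
  have -> : 'i *: ((a +i* b)%C *: y + z) = (- b +i* a)%C *: y + 'i *: z.
    by rewrite scalerDr scalerA; congr (_ *: _ + _); simpc.
  rewrite !uD (uC a b y) (uC (- b) a y); apply/eqP; rewrite eq_complex /=.
  by apply/andP; split; apply/eqP; ring.
(* The crude constant 2 suffices, since only membership in the dual is at stake. *)
have fN z : `|f z| <= 2 * `|z|.
  rewrite (le_trans (normC_le_ReIm _))//= normrN.
  have -> : 2 * `|z| = (N z + N ('i *: z))%:C.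
    by rewrite rmorphD /= !NC normrZ normCi mul1r mulr2n mulrDl mul1r.
  by rewrite lecR lerD.
have fP := dual_mem (ler0n _ 2) fl fN.
have := fx (Dual fP) => /(congr1 (@complex.Re R)) /= ux.
by move: uNx; rewrite uNE ux oppr0 oppr_ge0.
Qed.
End hahn_banach.

(** * Elementary facts on linear functionals *)

Section functionals.
Variables (R : realType) (V : normedModType R[i]).
Implicit Types f : V -> R[i].

Definition bounded_functional f :=
  exists2 k : R[i], 0 <= k & forall x, `|f x| <= k * `|x|.

Lemma scalarDZ f : scalar f ->
  (forall x y, f (x + y) = f x + f y) /\
  (forall k x, f (k *: x) = k * f x).
Proof.
move=> fl; have fD x y : f (x + y) = f x + f y.
  by have := fl 1 x y; rewrite scale1r mul1r.
have f0 : f 0 = 0 by apply: (addrI (f 0)); rewrite -fD !addr0.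
by split=> // k x; have := fl k x 0; rewrite !addr0 f0 addr0.
Qed.

Lemma scalar_eq1 f : scalar f -> f <> cst 0 -> exists u, f u = 1.
Proof.
move=> /scalarDZ[_ fZ] f0; have [v fv] : exists v, f v != 0.
  apply: contrapT => /forallNP h; apply: f0; apply/funext => v.
  by apply/eqP; have /negP/negPn := h v.
by exists ((f v)^-1 *: v); rewrite fZ mulVf.
Qed.

End functionals.

Lemma dualD (R : realType) (V : normedModType R[i]) (f : dual V) x y :
  f (x + y) = f x + f y.
Proof. exact: linearD. Qed.

Lemma dualZ (R : realType) (V : normedModType R[i]) (f : dual V) (k : R[i]) x :
  f (k *: x) = k * f x.
Proof. exact: linearZ. Qed.

(** * The opposite algebra, which exchanges left and right actions *)

Section opposite_algebra.
Variables (R : realType) (A : banachAlgType R).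

Definition opposite : Type := A.

HB.instance Definition _ := CompleteNormedModule.copy opposite A.

Let omul (a b : opposite) : opposite := (b : A) ** (a : A).

Let omulA : associative omul.
Proof. by move=> a b c; rewrite /omul bmulA. Qed.

Let omulDl : left_distributive omul +%R.
Proof. by move=> a b c; rewrite /omul bmulDr. Qed.

Let omulDr : right_distributive omul +%R.
Proof. by move=> a b c; rewrite /omul bmulDl. Qed.

Let omulZl (k : R[i]) a b : omul (k *: a) b = k *: omul a b.
Proof. exact: bmulZr. Qed.

Let omulZr (k : R[i]) a b : omul a (k *: b) = k *: omul a b.
Proof. exact: bmulZl. Qed.

Let ler_norm_omul a b : `|omul a b| <= `|a| * `|b|.
Proof. by rewrite mulrC ler_norm_bmul. Qed.

HB.instance Definition _ := isBanachAlgebra.Build R opposite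
  omulA omulDl omulDr omulZl omulZr ler_norm_omul.

Lemma opposite_mulE (a b : opposite) : a ** b = (b : A) ** (a : A).
Proof. by []. Qed.

End opposite_algebra.

(** * From character amenability to inner derivations for one-sided actions *)

Lemma H1_trivial_inner (R : realType) (A : banachAlgType R)
    (X : banachBimodType A) (d : A -> X) :
  H1_trivial X -> derivation d -> continuous d -> inner_derivation d.
Proof.
move=> H1X dd dc.
(* The zero map is inner, so [d] lies in its own coset, which is [B1]. *)
have B10 : B1 (fun=> 0 : X).
  exists 0 => a; have := lactZr (0 : R[i]) a (0 : X).
  have := ractZl (0 : R[i]) (0 : X) a.
  by rewrite !scale0r => -> ->; rewrite subrr.
have : @H1 _ _ X [set d \+ b | b in @B1 _ _ X] by exists d.
rewrite H1X => dB; rewrite -[inner_derivation d]/(B1 d) -dB.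
by exists (fun=> 0) => //; apply/funext => a /=; rewrite addr0.
Qed.

(* A module with a right action [r] only, made into a bimodule by letting [A]
   act on the left through [phi]. *)
Definition right_cohomology_trivial (R : realType) (A : banachAlgType R)
    (phi : A -> R[i]) :=
  forall (V : completeNormedModType R[i]) (r : V -> A -> V),
  (forall x y a, r (x + y) a = r x a + r y a) ->
  (forall (k : R[i]) x a, r (k *: x) a = k *: r x a) ->
  (forall v a b, r v (a + b) = r v a + r v b) ->
  (forall (k : R[i]) v a, r v (k *: a) = k *: r v a) ->
  (forall v a b, r v (a ** b) = r (r v a) b) ->
  (exists2 k : R[i], 0 <= k & forall v a, `|r v a| <= k * `|v| * `|a|) ->
  forall D : A -> dual V, linear D -> continuous D ->
  (forall a b v, D (a ** b) v = phi b * D a v + D b (r v a)) ->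
  exists F : dual V, forall a v, D a v = F (r v a) - phi a * F v.

Section character_amenability.
Variables (R : realType) (A : banachAlgType R) (phi : A -> R[i]).
Hypotheses (Aam : character_amenable A).
Hypotheses (phi_char : (Delta A `|` [set cst 0]) phi).
Hypotheses (phi_bounded : bounded_functional (V := A) phi).

Let phi_scalar : scalar phi.
Proof.
case: phi_char => [[]//|->] k x y.
by rewrite /cst mulr0 addr0.
Qed.

Let phiD : forall a b, phi (a + b) = phi a + phi b.
Proof. by case: (scalarDZ (V := A) phi_scalar). Qed.

Let phiZ : forall (k : R[i]) a, phi (k *: a) = k * phi a.
Proof. by case: (scalarDZ (V := A) phi_scalar). Qed.

Let phiM a b : phi (a ** b) = phi a * phi b.
Proof. by case: phi_char => [[]//|->]; rewrite /cst mulr0. Qed.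

Lemma amenable_right_trivial : right_cohomology_trivial phi.
Proof.
move=> V r rDl rZl rDr rZr rM rb D Dl Dc DM.
have lb : exists2 k : R[i], 0 <= k &
    forall a (v : V), `|phi a *: v| <= k * `|a| * `|v|.
  have [k k0 phik] := phi_bounded; exists k => // a v.
  by rewrite normrZ ler_wpM2r.
have lDl a b (v : V) : phi (a + b) *: v = phi a *: v + phi b *: v.
  by rewrite phiD scalerDl.
have lZl k a (v : V) : phi (k *: a) *: v = k *: (phi a *: v).
  by rewrite phiZ scalerA.
have lZr k a (v : V) : phi a *: (k *: v) = k *: (phi a *: v).
  by rewrite !scalerA mulrC.
have lM a b (v : V) : phi (a ** b) *: v = phi a *: (phi b *: v).
  by rewrite phiM scalerA.
pose mixin := isBanachBimodule.Build R A V
  lDl lZl (fun a => scalerDr (phi a)) lZr rDl rZl rDr rZr lM rM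
  (fun a v b => rZl (phi a) v b) lb rb.
pose X : banachBimodType A := HB.pack (CompleteNormedModule.sort V) mixin.
have X_char : character_action phi X by right.
have [||F DF] := @H1_trivial_inner R A (dual X) (D : A -> dual X)
  (Aam phi_char X_char).
- split=> // a b; apply: dualP => v.
  rewrite DM dual_addE dual_lactE dual_ractE /=.
  by congr (_ + _); rewrite dualZ.
- exact: Dc.
exists F => a v; rewrite (DF a) dual_addE dual_oppE dual_lactE dual_ractE.
by congr (_ - _); exact: dualZ.
Qed.


(** A right action of the opposite algebra is a left action of [A]; now [phi] acts on the right. *)
Lemma amenable_left_trivial :
  right_cohomology_trivial (phi : opposite A -> R[i]).
Proof.
move=> V r rDl rZl rDr rZr rM rb D Dl Dc DM.
have lb : exists2 k : R[i], 0 <= k &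
    forall (a : A) (v : V), `|r v a| <= k * `|a| * `|v|.
  by have [k k0 rk] := rb; exists k => // a v; rewrite mulrAC; exact: rk.
have rb' : exists2 k : R[i], 0 <= k &
    forall (v : V) (a : A), `|phi a *: v| <= k * `|v| * `|a|.
  have [k k0 phik] := phi_bounded; exists k => // v a.
  by rewrite normrZ mulrAC ler_wpM2r.
have r'Dr (v : V) (a b : A) : phi (a + b) *: v = phi a *: v + phi b *: v.
  by rewrite phiD scalerDl.
have r'Zr k (v : V) (a : A) : phi (k *: a) *: v = k *: (phi a *: v).
  by rewrite phiZ scalerA.
have r'Zl k (v : V) (a : A) : phi a *: (k *: v) = k *: (phi a *: v).
  by rewrite !scalerA mulrC.
have r'M (v : V) (a b : A) : phi (a ** b) *: v = phi b *: (phi a *: v).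
  by rewrite phiM scalerA mulrC.
have lM (a b : A) v : r v (a ** b : A) = r (r v b) a by exact: rM.
pose mixin := isBanachBimodule.Build R A V
  (fun (a b : A) v => rDr v a b) (fun k (a : A) v => rZr k v a)
  (fun (a : A) x y => rDl x y a) (fun k (a : A) x => rZl k x a)
  (fun (x y : V) (a : A) => scalerDr (phi a) x y) r'Zl r'Dr r'Zr
  lM r'M (fun (a : A) v b => esym (rZl (phi b) v a)) lb rb'.
pose X : banachBimodType A := HB.pack (CompleteNormedModule.sort V) mixin.
have X_char : character_action phi X by left.
have [||F DF] := @H1_trivial_inner R A (dual X) (D : A -> dual X)
  (Aam phi_char X_char).
- split=> // a b; apply: dualP => v.
  rewrite [a ** b](_ : _ = (b : opposite A) ** (a : opposite A))// DM.
  rewrite dual_addE dual_lactE dual_ractE /= addrC.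
  by congr (_ + _); rewrite dualZ.
- exact: Dc.
(* Exchanging the sides reverses the commutator, hence the sign. *)
exists (- F) => a v; rewrite (DF a) !dual_addE !dual_oppE dual_lactE dual_ractE.
by rewrite mulrN opprK addrC; congr (_ + _); exact: dualZ.
Qed.

End character_amenability.

(** * Translates of functionals and the embedding into the bidual *)

Lemma bounded_linear_continuous (R : realType) (V W : normedModType R[i])
    (d : V -> W) (k : R[i]) :
  0 <= k -> linear d -> (forall x, `|d x| <= k * `|x|) -> continuous d.
Proof.
move=> k0 dl dk.
pose d' : {linear V -> W} := HB.pack d (GRing.isLinear.Build _ _ _ _ d dl).
apply/(@linear_bounded_continuous _ _ _ d')/linear_boundedP.
near=> r => x; rewrite (le_trans (dk x))// ler_wpM2r//.
by near: r; apply: nbhs_pinfty_ge; exact: ger0_real.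
Unshelve. all: by end_near. Qed.

Section dual_mul.
Variables (R : realType) (B : banachAlgType R).
Implicit Types (f g : dual B) (a b x : B).

Fact dual_mul_proof f a : (fun x => f (a ** x)) \in @dual_pred R B.
Proof.
apply: (@dual_mem _ _ _ (`|f| * `|a|)); first by rewrite mulr_ge0.
  by move=> k x y; rewrite bmulDr bmulZr linearP.
move=> x; rewrite (le_trans (ler_dual_norm _ _))// -mulrA ler_wpM2l//.
exact: ler_norm_bmul.
Qed.

(** The canonical right action on the dual, the first step of the Arens product. *)
Definition dual_mul f a : dual B := Dual (dual_mul_proof f a).

Lemma dual_mulE f a x : dual_mul f a x = f (a ** x). Proof. by []. Qed.

Lemma dual_mulDl f g a : dual_mul (f + g) a = dual_mul f a + dual_mul g a.
Proof. exact: dualP. Qed.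

Lemma dual_mulZl (k : R[i]) f a : dual_mul (k *: f) a = k *: dual_mul f a.
Proof. exact: dualP. Qed.

Lemma dual_mulDr f a b : dual_mul f (a + b) = dual_mul f a + dual_mul f b.
Proof. by apply: dualP => x; rewrite dual_addE !dual_mulE bmulDl dualD. Qed.

Lemma dual_mulZr (k : R[i]) f a : dual_mul f (k *: a) = k *: dual_mul f a.
Proof. by apply: dualP => x; rewrite dual_scaleE !dual_mulE bmulZl dualZ. Qed.

Lemma dual_mulA f a b : dual_mul f (a ** b) = dual_mul (dual_mul f a) b.
Proof. by apply: dualP => x; rewrite !dual_mulE bmulA. Qed.

Lemma dual_mul_norm f a : `|dual_mul f a| <= `|f| * `|a|.
Proof.
apply: dual_norm_leM => [|x]; first by rewrite mulr_ge0.
rewrite dual_mulE (le_trans (ler_dual_norm _ _))// -mulrA ler_wpM2l//.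
exact: ler_norm_bmul.
Qed.

End dual_mul.

Section evaluation.
Variables (R : realType) (V : normedModType R[i]).

Fact dual_eval_proof (x : V) :
  (fun f : dual V => f x) \in @dual_pred R (dual V).
Proof.
apply: (@dual_mem _ _ _ `|x|) => [//|k f g|f] //.
by rewrite mulrC ler_dual_norm.
Qed.

Definition dual_eval (x : V) : dual (dual V) := Dual (dual_eval_proof x).

Lemma dual_evalE (x : V) (f : dual V) : dual_eval x f = f x. Proof. by []. Qed.

Lemma dual_eval_norm (x : V) : `|dual_eval x| <= `|x|.
Proof.
by apply: dual_norm_leM => // f; rewrite dual_evalE mulrC ler_dual_norm.
Qed.

Lemma dual_eval_linear : linear dual_eval.
Proof. by move=> k x y; apply: dualP => f; rewrite dual_evalE dualD dualZ. Qed.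

End evaluation.

(** * One-sided units and invariant means in the bidual *)

Section right_mean.
Variables (R : realType) (B : banachAlgType R).

(** For the zero left action, the embedding of [B] into its bidual is a derivation; a functional
    implementing it is the unit. *)
Lemma right_unit :
  right_cohomology_trivial (cst 0 : B -> R[i]) ->
  exists E : dual (dual B), forall a f, E (dual_mul f a) = f a.
Proof.
move=> triv.
have [||a b f|E DE] := triv (dual B) (@dual_mul R B) (@dual_mulDl R B)
  (@dual_mulZl R B) (@dual_mulDr R B) (@dual_mulZr R B) (@dual_mulA R B) _
  (@dual_eval R B) (@dual_eval_linear R B).
- by exists 1 => // f a; rewrite mul1r dual_mul_norm.
- apply: (bounded_linear_continuous ler01 (@dual_eval_linear R B)) => a.
  by rewrite mul1r dual_eval_norm.
- by rewrite mul0r add0r.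
by exists E => a f; rewrite -[RHS]dual_evalE DE mul0r subr0.
Qed.

Variables (phi : dual B).
Hypothesis phiM : forall a b, phi (a ** b) = phi a * phi b.

(* The action on [dual B] induced from the quotient [dual B / phi], the latter
   being identified with the annihilator of [u]. *)
Lemma right_invariant_mean (u : B) : phi u = 1 ->
  right_cohomology_trivial (phi : B -> R[i]) ->
  exists m : dual (dual B),
    m phi = 1 /\ forall a f, m (dual_mul f a) = phi a * m f.
Proof.
move=> phiu triv.
(* The translate of [f] is projected along [phi] onto the annihilator of [u]. *)
have [r rdef] : exists r : dual B -> B -> dual B,
  forall f a, r f a = dual_mul f a - f (a ** u) *: phi by eexists.
have rE f a x : r f a x = f (a ** x) - f (a ** u) * phi x by rewrite rdef.
(* For the untwisted action, [D] is the inner derivation given by evaluation at [u]. Its values kill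
   [phi]; if [F] implements [D] and also kills [phi], then [dual_eval u - F] is the invariant
   mean. *)
have [D Ddef] : exists D : B -> dual (dual B),
  forall a, D a = dual_eval (a ** u) - phi a *: dual_eval u by eexists.
have DE a f : D a f = f (a ** u) - phi a * f u by rewrite Ddef.
have Dl : linear D.
  move=> k a b; apply: dualP => f.
  rewrite dual_addE dual_scaleE !DE bmulDl bmulZl !dualD !dualZ.
  rewrite /GRing.scale/=; ring.
have [||||||||F DF] := triv (dual B) r _ _ _ _ _ _ D Dl.
- by move=> f g a; apply: dualP => x; rewrite dual_addE !rE !dual_addE; ring.
- move=> k f a; apply: dualP => x; rewrite dual_scaleE !rE !dual_scaleE.
  rewrite /GRing.scale/=; ring.
- move=> f a b; apply: dualP => x; rewrite dual_addE !rE !bmulDl !dualD; ring.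
- move=> k f a; apply: dualP => x; rewrite dual_scaleE !rE !bmulZl !dualZ.
  rewrite /GRing.scale/=; ring.
- move=> f a b; apply: dualP => x; rewrite !rE !phiM phiu !bmulA; ring.
- exists (1 + `|u| * `|phi|); first by rewrite addr_ge0// mulr_ge0.
  move=> f a; rewrite rdef (le_trans (ler_normB _ _))// !mulrDl mul1r lerD//.
    exact: dual_mul_norm.
  rewrite normrZ [leRHS](_ : _ = (`|f| * (`|a| * `|u|)) * `|phi|); last by ring.
  rewrite ler_wpM2r// (le_trans (ler_dual_norm _ _))// ler_wpM2l//.
  exact: ler_norm_bmul.
- apply: (@bounded_linear_continuous _ _ _ _ (`|u| + `|phi| * `|u|)) => //.
    by rewrite addr_ge0// mulr_ge0.
  move=> a; rewrite Ddef (le_trans (ler_normB _ _))// mulrDl lerD//.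
    by rewrite (le_trans (dual_eval_norm _))// mulrC ler_norm_bmul.
  rewrite normrZ mulrAC ler_pM//; first exact: ler_dual_norm.
  exact: dual_eval_norm.
- move=> a b f; rewrite !DE !rE !phiM phiu !bmulA; ring.
have rphi a : r phi a = 0.
  by apply: dualP => x; rewrite rE !phiM phiu mulr1 subrr.
have Fphi : F phi = 0.
  have := DF u phi; rewrite DE rphi linear0 phiM phiu !mul1r subrr sub0r.
  by move/eqP; rewrite eq_sym oppr_eq0 => /eqP.
exists (dual_eval u - F); split=> [|a f].
  by rewrite dual_addE dual_oppE dual_evalE Fphi phiu subr0.
rewrite !dual_addE !dual_oppE !dual_evalE dual_mulE.
have Fr : F (r f a) = F (dual_mul f a).
  by rewrite rdef linearB linearZ /= Fphi scaler0 subr0.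
have := DF a f; rewrite DE Fr => h.
by rewrite -[F (dual_mul f a)](subrK (phi a * F f)) -h; ring.
Qed.

(** A multiple of the invariant mean is subtracted from the unit so as to kill [phi]; on translates
    by the kernel of [phi] the invariant mean vanishes, so the unit property survives there. *)
Lemma right_mean (u : B) : phi u = 1 ->
  right_cohomology_trivial (cst 0 : B -> R[i]) ->
  right_cohomology_trivial (phi : B -> R[i]) ->
  exists E : dual (dual B),
    E phi = 0 /\ forall a f, phi a = 0 -> E (dual_mul f a) = f a.
Proof.
move=> phiu triv0 triv.
have [E0 E0E] := right_unit triv0.
have [m [m1 mE]] := right_invariant_mean phiu triv.
exists (E0 - E0 phi *: m); split=> [|a f a0].
  by rewrite dual_addE dual_oppE dual_scaleE m1 [_ *: _]mulr1 subrr.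
by rewrite dual_addE dual_oppE dual_scaleE mE a0 mul0r scaler0 subr0.
Qed.

(* Two-sided means on the kernel of a character *)
End right_mean.

Section two_sided_mean.
Variables (R : realType) (B : banachAlgType R).

(* [M f] plays the role of the limit of [f] along an approximate identity of
   the kernel of [phi]. *)
Definition kernel_mean (phi : B -> R[i]) (M : dual B -> R[i]) :=
  [/\ forall f g, M (f + g) = M f + M g,
    forall f g : dual B, (forall x, phi x = 0 -> f x = g x) -> M f = M g,
    forall (f h : dual B) a, phi a = 0 ->
      (forall x, h x = f (a ** x)) -> M h = f a &
    forall (f h : dual B) a, phi a = 0 ->
      (forall x, h x = f (x ** a)) -> M h = f a].

Lemma kernel_eq_proportional (phi f g : dual B) (u : B) : phi u = 1 ->
  (forall x, phi x = 0 -> f x = g x) -> exists c : R[i], f = g + c *: phi.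
Proof.
move=> phiu fg; exists (f u - g u); apply: dualP => x.
rewrite dual_addE dual_scaleE /GRing.scale/=.
have /fg : phi (x - phi x *: u) = 0.
  by rewrite linearB /= dualZ phiu mulr1 subrr.
rewrite !linearB /= !dualZ => /eqP; rewrite -subr_eq0 => /eqP h.
by apply/eqP; rewrite -subr_eq0 -h; apply/eqP; ring.
Qed.

Lemma two_sided_mean (phi : dual B) (u : B) (E E' : dual (dual B)) :
  phi u = 1 ->
  E phi = 0 -> (forall (f h : dual B) a, phi a = 0 ->
    (forall x, h x = f (a ** x)) -> E h = f a) ->
  E' phi = 0 -> (forall (f h : dual B) a, phi a = 0 ->
    (forall x, h x = f (x ** a)) -> E' h = f a) ->
  (forall a b, phi (a ** b) = phi a * phi b) ->
  exists M, kernel_mean phi M.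
Proof.
move=> phiu Ephi EE E'phi E'E phiM.
have psiP f : (fun y => E' (dual_mul f y)) \in @dual_pred R B.
  apply: (@dual_mem _ _ _ (`|E'| * `|f|)); first by rewrite mulr_ge0.
    by move=> k x y; rewrite dual_mulDr dual_mulZr dualD dualZ.
  move=> x; rewrite (le_trans (ler_dual_norm _ _))// -mulrA ler_wpM2l//.
  exact: dual_mul_norm.
(* [E (psi f)] is the Arens product of [E] and [E'], evaluated at [f]. *)
pose psi f : dual B := Dual (psiP f).
have psiE f y : psi f y = E' (dual_mul f y) by [].
have psiD f g : psi (f + g) = psi f + psi g.
  by apply: dualP => y; rewrite dual_addE !psiE dual_mulDl dualD.
have psiZ k f : psi (k *: f) = k *: psi f.
  by apply: dualP => y; rewrite dual_scaleE !psiE dual_mulZl dualZ.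
have psiphi : psi phi = 0.
  apply: dualP => y; rewrite psiE.
  have -> : dual_mul phi y = phi y *: phi.
    by apply: dualP => x; rewrite dual_mulE phiM.
  by rewrite dualZ E'phi mulr0.
(* the two-sided unit [E + E' - E E'] of the bidual *)
exists (fun f => E f + E' f - E (psi f)); split.
- by move=> f g; rewrite psiD !dualD; ring.
- move=> f g /(kernel_eq_proportional phiu)[c ->].
  by rewrite psiD psiZ psiphi !dualD !dualZ Ephi E'phi linear0; ring.
(* Here [psi] commutes with the translation, so [E (psi h)] cancels [E' h]. *)
- move=> f h a a0 hE.
  have -> : E' h = psi f a by rewrite psiE; congr (E' _); apply: dualP => x.
  rewrite (EE f h a)// (EE (psi f) (psi h) a)//; first by ring.
  move=> x; rewrite !psiE; congr (E' _); apply: dualP => y.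
  by rewrite !dual_mulE hE bmulA.
(* Here [psi] fixes [h], so [E (psi h)] cancels [E h]. *)
- move=> f h a a0 hE.
  have -> : psi h = h.
    apply: dualP => y; rewrite psiE (E'E (dual_mul f y) _ a)//.
    by move=> x; rewrite !dual_mulE hE bmulA.
  by rewrite (E'E f h a)//; ring.
Qed.

End two_sided_mean.

Section amenable_mean.
Variables (R : realType) (A : banachAlgType R) (phi : A -> R[i]).
Hypotheses (Aam : character_amenable A) (phiD : Delta A phi).
Hypothesis phib : bounded_functional (V := A) phi.

(** [A] provides the mean for one side and its opposite algebra the mean for the other. *)
Lemma amenable_kernel_mean : exists M, kernel_mean phi M.
Proof.
have [phil phiM phin0] := phiD.
have [k k0 phik] := phib.
have phid : phi \in @dual_pred R A by exact: (dual_mem k0).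
pose f : dual A := Dual phid.
have [u fu] : exists u, f u = 1 by exact: (scalar_eq1 (V := A) phil phin0).
have b0 : bounded_functional (V := A) (cst 0 : A -> R[i]).
  by exists 0 => // x; rewrite normr0 mul0r.
have [E [Ephi EE]] := right_mean (B := A) (phi := f) phiM fu
  (amenable_right_trivial Aam (or_intror erefl) b0)
  (amenable_right_trivial Aam (or_introl phiD) phib).
have [E' [E'phi E'E]] := right_mean (B := opposite A) (phi := f)
  (fun a b => etrans (phiM b a) (mulrC _ _)) fu
  (amenable_left_trivial Aam (or_intror erefl) b0)
  (amenable_left_trivial Aam (or_introl phiD) phib).
apply: (@two_sided_mean _ _ f u E E') => //.
- by move=> g h a a0 hE; rewrite -EE//; congr (E _); apply: dualP.
- by move=> g h a a0 hE; rewrite -(E'E a g a0); congr (E' _); apply: dualP.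
Qed.

End amenable_mean.

(** * Jordan derivations when one action is given by a character *)

Section jordan.
Variables (R : realType) (B : banachAlgType R) (V : normedModType R[i]).
Variables (phi : B -> R[i]) (M : dual B -> R[i]) (L : B -> V -> V) (T : B -> V).
Hypotheses (phiD : forall a b, phi (a + b) = phi a + phi b)
  (phiZ : forall k a, phi (k *: a) = k * phi a)
  (phiM : forall a b, phi (a ** b) = phi a * phi b)
  (phi1 : exists u, phi u = 1).
Hypothesis meanM : kernel_mean phi M.
Hypotheses (LDl : forall a b v, L (a + b) v = L a v + L b v)
  (LZl : forall (k : R[i]) a v, L (k *: a) v = k *: L a v)
  (LDr : forall a v w, L a (v + w) = L a v + L a w)
  (LZr : forall (k : R[i]) a v, L a (k *: v) = k *: L a v)
  (LM : forall a b v, L (a ** b) v = L a (L b v))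
  (Lb : exists2 k : R[i], 0 <= k & forall a v, `|L a v| <= k * `|a| * `|v|).
Hypotheses (Tl : linear T) (Tc : continuous T).
Hypothesis TJ : forall a b, T (a ** b + b ** a) =
  (phi b *: T a + phi a *: T b) + (L a (T b) + L b (T a)).
Implicit Types (g : dual V) (a b c d x : B).

Let TD a b : T (a + b) = T a + T b.
Proof. by have := Tl 1 a b; rewrite !scale1r. Qed.

Let T0 : T 0 = 0.
Proof. by apply: (addrI (T 0)); rewrite -TD !addr0. Qed.

Let TZ (k : R[i]) a : T (k *: a) = k *: T a.
Proof. by have := Tl k a 0; rewrite !addr0 T0 addr0. Qed.

Let TJ0 a b : phi a = 0 -> phi b = 0 ->
  T (a ** b) + T (b ** a) = L a (T b) + L b (T a).
Proof. by move=> a0 b0; rewrite -TD TJ a0 b0 !scale0r !add0r. Qed.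

Let TJ3 a b c : phi a = 0 -> phi b = 0 -> phi c = 0 ->
  T (a ** b ** c) + T (a ** c ** b) + (T (b ** c ** a) + T (c ** b ** a)) =
  L (a ** b) (T c) + L (a ** c) (T b) + (L (b ** c) (T a) + L (c ** b) (T a)).
Proof.
move=> a0 b0 c0; rewrite -!TD -!bmulA -!bmulDr !bmulA -!bmulDl TD TJ0//; last first.
  by rewrite phiD !phiM b0 c0 !mul0r addr0.
by rewrite TD TJ0// LDl LDr !LM.
Qed.

Lemma jordan_triple g a b c : phi a = 0 -> phi b = 0 -> phi c = 0 ->
  g (T (a ** b ** c)) + g (T (c ** b ** a)) =
  g (L (a ** b) (T c)) + g (L (c ** b) (T a)).
Proof.
move=> a0 b0 c0.
(* Expanding [T] on the Jordan products a(bc), c(ab) and b(ac), the first two minus the third give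
   twice the claim. *)
have E1 := congr1 g (TJ3 a0 b0 c0); have E2 := congr1 g (TJ3 c0 a0 b0).
have E3 := congr1 g (TJ3 b0 a0 c0); rewrite !dualD in E1 E2 E3.
apply: (mulfI (_ : 2 != 0 :> R[i])); first by rewrite pnatr_eq0.
apply/eqP; rewrite -subr_eq0; apply/eqP.
have /eqP := f_equal2 (fun y z => y - z) (f_equal2 +%R E1 E2) E3.
by rewrite -subr_eq0 => /eqP E; rewrite -[RHS]E /=; ring.
Qed.

Let gT_proof g : (fun x => g (T x)) \in @dual_pred R B.
Proof.
apply/mem_set; split; first by move=> k x y; rewrite Tl dualD dualZ.
by move=> x; apply: continuous_comp; [exact: Tc|exact: dual_continuous].
Qed.

Let gT g : dual B := Dual (gT_proof g).

Let gL_proof g a : (fun v => g (L a v)) \in @dual_pred R V.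
Proof.
have [k k0 Lk] := Lb.
apply: (@dual_mem _ _ _ (`|g| * (k * `|a|))); first by rewrite !mulr_ge0.
  by move=> l v w; rewrite LDr LZr dualD dualZ.
by move=> v; rewrite (le_trans (ler_dual_norm _ _))// -mulrA ler_wpM2l.
Qed.

Let gL g a : dual V := Dual (gL_proof g a).

Let ev_proof g v : (fun x => g (L x v)) \in @dual_pred R B.
Proof.
have [k k0 Lk] := Lb.
apply: (@dual_mem _ _ _ (`|g| * (k * `|v|))); first by rewrite !mulr_ge0.
  by move=> l x y; rewrite LDl LZl dualD dualZ.
move=> x; rewrite (le_trans (ler_dual_norm _ _))// -mulrA ler_wpM2l//.
by rewrite mulrAC.
Qed.

Let ev g v : dual B := Dual (ev_proof g v).

Let mean_ev g a v : phi a = 0 -> M (ev g (L a v)) = g (L a v).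
Proof.
have [_ _ _ MR] := meanM; move=> a0.
by rewrite (MR (ev g v) (ev g (L a v)) a a0)// => x; rewrite /ev /= LM.
Qed.

(** Let [c] run along [M] in [jordan_triple]: the left side tends to
    [g (T (a ** b)) + g (T (b ** a))], the last term to [g (L b (T a))], and [TJ0] gives the
    remaining limit. *)
Let mean_T g a b : phi a = 0 -> phi b = 0 ->
  M (gT (gL g (a ** b))) = g (L a (T b)).
Proof.
move=> a0 b0; have [MD Meq ML MR] := meanM.
(* Translation in the opposite algebra multiplies the argument on the right. *)
pose r : dual B := dual_mul (B := opposite B) (gT g) (b ** a).
have rE x : r x = g (T (x ** (b ** a))) by [].
have : M (dual_mul (gT g) (a ** b) + r) =
    M (gT (gL g (a ** b)) + ev g (L b (T a))).
  apply: Meq => x x0; rewrite !dual_addE dual_mulE rE /= !bmulA.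
  by rewrite jordan_triple// (LM x b).
rewrite !MD (ML (gT g) _ (a ** b))//; last by rewrite phiM a0 mul0r.
rewrite (MR (gT g) r (b ** a))//; last by rewrite phiM a0 mulr0.
rewrite mean_ev// => h; apply: (addIr (g (L b (T a)))).
by rewrite -h /= -!dualD TJ0.
Qed.

(* Dually to [mean_T], [M] computes [2 T (a b)] as [a T b + lim e T (a b)]. *)
Let kernel_act_derivation g a b d : phi a = 0 -> phi b = 0 -> phi d = 0 ->
  g (L d (T (a ** b))) = g (L d (L a (T b))).
Proof.
move=> a0 b0 d0; have [MD Meq ML MR] := meanM.
have ab0 : phi (a ** b) = 0 by rewrite phiM a0 mul0r.
have key (h : dual V) : h (T (a ** b)) + h (T (a ** b)) =
    h (L a (T b)) + M (ev h (T (a ** b))).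
  pose r : dual B := dual_mul (B := opposite B) (gT h) (a ** b).
  have rE x : r x = h (T (x ** (a ** b))) by [].
  have : M (dual_mul (gT h) (a ** b) + r) =
      M (gT (gL h (a ** b)) + ev h (T (a ** b))).
    apply: Meq => x x0; rewrite !dual_addE dual_mulE rE /=.
    by rewrite -!dualD TJ0.
  by rewrite !MD (ML (gT h) _ (a ** b))// (MR (gT h) r (a ** b))// mean_T.
(* For this functional the limit in [key] is [g (L d (T (a ** b)))], as [d] is in the kernel, and
   cancels one copy on the left. *)
have := key (gL g d).
have -> : M (ev (gL g d) (T (a ** b))) = g (L d (T (a ** b))).
  by rewrite (ML (ev g (T (a ** b))) _ d)// => x; rewrite /= LM.
by move=> /= /addIr.
Qed.

(** By [kernel_act_derivation], [L x (T (a ** b))] and [L x (L a (T b))] agree for [x] in the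
    kernel, so the limit of the former along [M] is [L a (T b)]; thus twice [T (a ** b)] is twice
    [L a (T b)]. *)
Lemma kernel_derivation a b : phi a = 0 -> phi b = 0 -> T (a ** b) = L a (T b).
Proof.
move=> a0 b0; apply/eqP; rewrite -subr_eq0; apply/eqP/dual_separates => g.
have [MD Meq ML MR] := meanM.
have ab0 : phi (a ** b) = 0 by rewrite phiM a0 mul0r.
have : M (dual_mul (gT g) (a ** b) +
      dual_mul (B := opposite B) (gT g) (a ** b)) =
    M (gT (gL g (a ** b)) + ev g (T (a ** b))).
  by apply: Meq => x x0; rewrite !dual_addE dual_mulE /= -!dualD TJ0.
rewrite !MD (ML (gT g) _ (a ** b))// (MR (gT g) _ (a ** b))// mean_T//.
rewrite (Meq (ev g (T (a ** b))) (ev g (L a (T b)))) => [|x x0]; last first.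
  exact: kernel_act_derivation.
rewrite mean_ev// => E; apply: (mulfI (_ : 2 != 0 :> R[i])).
  by rewrite pnatr_eq0.
rewrite linearB /= mulr0 mulrBr.
by move/eqP: E; rewrite -subr_eq0 => /eqP E; rewrite -[RHS]E /=; ring.
Qed.

(** A weak density of products in the kernel: [f a] is the mean of [f (a ** x)]. *)
Let kernel_functional_eq (f h : dual B) :
  (forall a b, phi a = 0 -> phi b = 0 -> f (a ** b) = h (a ** b)) ->
  forall a, phi a = 0 -> f a = h a.
Proof.
move=> fh a a0; have [MD Meq ML MR] := meanM.
rewrite -(ML f (dual_mul f a) a)// -(ML h (dual_mul h a) a)//.
by apply: Meq => x x0; exact: fh.
Qed.

(** On products [a ** b] in the kernel, [kernel_derivation] applies to [(u ** a) ** b] and to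
    [a ** b]; products determine functionals on the kernel. *)
Let left_derivation u a : phi a = 0 -> T (u ** a) = L u (T a).
Proof.
move=> a0; apply/eqP; rewrite -subr_eq0; apply/eqP/dual_separates => g.
apply/eqP; rewrite linearB subr_eq0; apply/eqP.
apply: (@kernel_functional_eq (dual_mul (gT g) u) (gT (gL g u))) a0.
move=> {}a b a0 b0.
rewrite dual_mulE /= bmulA kernel_derivation ?phiM ?a0 ?mulr0//.
by rewrite LM -kernel_derivation.
Qed.

Lemma jordan_derivation_eq a b : T (a ** b) = phi b *: T a + L a (T b).
Proof.
have phi0 : phi 0 = 0 by apply: (addrI (phi 0)); rewrite -phiD !addr0.
have phiN c : phi (- c) = - phi c by rewrite -scaleN1r phiZ mulN1r.
have [u u1] := phi1.
(* The Jordan identity for [c] and [u], less the known value of [T (u ** c)]. *)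
have right_derivation c : phi c = 0 -> T (c ** u) = T c + L c (T u).
  move=> c0; have := TJ c u; rewrite TD (left_derivation u c0).
  by rewrite u1 c0 scale1r scale0r addr0 addrA => /addIr.
have uu : T (u ** u) = T u + L u (T u).
  apply: (@scalerI _ _ (2%:R : R[i])); first by rewrite pnatr_eq0.
  by rewrite !scaler_nat !mulr2n -TD TJ u1 scale1r addrACA.
have split_u c : exists c', phi c' = 0 /\ c = c' + phi c *: u.
  exists (c - phi c *: u); rewrite subrK; split=> //.
  by rewrite phiD phiN phiZ u1 mulr1 subrr.
(* Both factors split along the kernel and the line of [u], which leaves the cases already
   settled. *)
have [[a' [a0 aE]] [b' [b0 bE]]] := (split_u a, split_u b).
have TaE : T (a ** u) = T a + L a (T u).
  rewrite {1 2 3}aE bmulDl bmulZl !TD !TZ LDl LZl right_derivation// uu.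
  by rewrite scalerDr addrACA.
rewrite {1 3}bE bmulDr bmulZr !TD !TZ TaE (left_derivation a b0) LDr LZr.
by rewrite scalerDr addrCA.
Qed.
End jordan.

(** * Boundedness of the character and the two sides of its action *)

Lemma kernel_mean_opposite (R : realType) (A : banachAlgType R)
    (phi : A -> R[i]) (M : dual A -> R[i]) :
  kernel_mean phi M -> kernel_mean (phi : opposite A -> R[i]) M.
Proof. by move=> [MD Meq ML MR]; split. Qed.

(** The bound on the action, divided by the norm of a nonzero vector, bounds [phi]. *)
Lemma character_bounded (R : realType) (A : banachAlgType R)
    (phi : A -> R[i]) (X : banachBimodType A) (x : X) :
  character_action phi X -> x != 0 -> bounded_functional (V := A) phi.
Proof.
move=> X_phi x0; have nx0 : 0 < `|x| by rewrite normr_gt0.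
case: X_phi => phiE.
- have [k k0 Xk] := @ract_bounded _ _ X; exists k => // a.
  rewrite -(ler_pM2r nx0) -normrZ -phiE (le_trans (Xk x a))//.
  by rewrite mulrAC.
- have [k k0 Xk] := @lact_bounded _ _ X; exists k => // a.
  by rewrite -(ler_pM2r nx0) -normrZ -phiE.
Qed.

Theorem corollary4p2 (R : realType) (A : banachAlgType R) :
  character_amenable A ->
  forall phi : A -> R[i], Delta A phi ->
  forall X : banachBimodType A, character_action phi X ->
  forall d : A -> X, continuous d -> jordan_derivation d -> derivation d.
Proof.
move=> Aam phi phiA X X_phi d dc [dl dJ]; split=> // a b.
have [[x x0]|X0] := pselect (exists x : X, x != 0); last first.
  (* In the zero module every identity holds. *)
  apply: contrapT => /eqP ne; apply: X0.
  by exists (d (a ** b) - (d a <* b + a *> d b)); rewrite subr_eq0.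
have [M meanM] := amenable_kernel_mean Aam phiA (character_bounded X_phi x0).
have [phil phiM phin0] := phiA.
have [phiD phiZ] := scalarDZ (V := A) phil.
have phi1 := scalar_eq1 (V := A) phil phin0.
case: X_phi => phiE.
- rewrite phiE; apply: (jordan_derivation_eq phiD phiZ phiM phi1 meanM
    (L := fun c y => c *> y)) => //.
  + exact: lactDl.
  + exact: lactZl.
  + exact: lactDr.
  + exact: lactZr.
  + exact: lact_mul.
  + exact: lact_bounded.
  + move=> c e; rewrite -[c ** e + _]/(jprod c e) dJ /jact !phiE.
    by rewrite addrACA addrC [X in _ + X]addrC.
- rewrite phiE addrC.
  (* In the opposite algebra the product of [b] and [a] is [a ** b], hence the swapped arguments. *)
  apply: (@jordan_derivation_eq R (opposite A) X phi M (fun c y => y <* c) d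
    phiD phiZ _ phi1 (kernel_mean_opposite meanM) _ _ _ _ _ _ dl dc _ b a).
  + by move=> c e; rewrite opposite_mulE phiM mulrC.
  + by move=> c e y; exact: ractDr.
  + by move=> k c y; exact: ractZr.
  + by move=> c y z; exact: ractDl.
  + by move=> k c y; exact: ractZl.
  + by move=> c e y; exact: ract_mul.
  + have [k k0 Xk] := @ract_bounded _ _ X; exists k => // c y.
    by rewrite mulrAC; exact: Xk.
  + move=> c e; rewrite [c ** e + _](_ : _ = jprod (e : A) (c : A)) ?dJ//.
    by rewrite /jact !phiE addrACA [X in X + _]addrC.
Qed.
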